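(* The trace monoid $T(P_4)$ embeds into the monoid $S=M_2\times M_2\times M_2$, where $M_2=\{x,y\}^*$ is the free monoid of rank $2$; that is, there is an injective monoid homomorphism $T(P_4)\to S$.
   Context: $T(P_4)$ is the monoid given by the monoid presentation $\langle\alpha_1,\alpha_2,\alpha_3,\alpha_4\mid\alpha_1\alpha_2=\alpha_2\alpha_1,\ \alpha_2\alpha_3=\alpha_3\alpha_2,\ \alpha_3\alpha_4=\alpha_4\alpha_3\rangle$. *)

(* Defs.v *)
From HB Require Import structures.
From mathcomp Require Import all_boot boolp.

Set Implicit Arguments.
Unset Strict Implicit.
Unset Printing Implicit Defensive.

Local Open Scope group_scope.
Local Open Scope quotient_scope.

(* A distinct name for [seq A], so that the monoid structure is not put on
   [seq A] itself. *)
Definition freeMonoid (A : choiceType) : Type := seq A.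

HB.instance Definition _ (A : choiceType) := Choice.on (freeMonoid A).

HB.instance Definition _ (A : choiceType) :=
  isMonoid.Build (freeMonoid A) (@catA A) (@cat0s A) (@cats0 A).

Definition gen (A : choiceType) (a : A) : freeMonoid A := [:: a].

Section Presentation.
Variables (A : choiceType) (R : freeMonoid A -> freeMonoid A -> Prop).

(* The least monoid congruence on words over A containing R. *)
Inductive pres_cong : freeMonoid A -> freeMonoid A -> Prop :=
| pres_cong_rel u v of R u v : pres_cong u v
| pres_cong_refl u : pres_cong u u
| pres_cong_sym u v of pres_cong u v : pres_cong v u
| pres_cong_trans u v w of pres_cong u v & pres_cong v w : pres_cong u w
| pres_cong_mul u u' v v' of pres_cong u u' & pres_cong v v' :
    pres_cong (u * v) (u' * v').

Definition pres_congb : rel (freeMonoid A) := fun u v => `[< pres_cong u v >].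

Lemma pres_congb_refl : reflexive pres_congb.
Proof. by move=> u; apply/asboolP; exact: pres_cong_refl. Qed.

Lemma pres_congb_sym : symmetric pres_congb.
Proof. by move=> u v; apply/asboolP/asboolP; exact: pres_cong_sym. Qed.

Lemma pres_congb_trans : transitive pres_congb.
Proof.
move=> v u w /asboolP uv /asboolP vw.
by apply/asboolP; exact: pres_cong_trans uv vw.
Qed.

Canonical pres_equiv :=
  EquivRel pres_congb pres_congb_refl pres_congb_sym pres_congb_trans.

Definition presMonoid : Type := {eq_quot pres_equiv}.

HB.instance Definition _ := Choice.on presMonoid.
HB.instance Definition _ := EqQuotient.on presMonoid.

Definition pres_class (u : freeMonoid A) : presMonoid := \pi_presMonoid u.

Lemma pres_classP u v : pres_class u = pres_class v <-> pres_cong u v.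
Proof.
split=> [/eqP|uv]; first by rewrite /pres_class piE => /asboolP.
by apply/eqP; rewrite /pres_class piE; apply/asboolP.
Qed.

Lemma pres_class_surj (a : presMonoid) : exists u, a = pres_class u.
Proof. by exists (repr a); rewrite /pres_class reprK. Qed.

Definition pres_mul (a b : presMonoid) : presMonoid :=
  pres_class (repr a * repr b).

Lemma pres_mulE u v :
  pres_mul (pres_class u) (pres_class v) = pres_class (u * v).
Proof.
by apply/pres_classP; apply: pres_cong_mul; apply/pres_classP;
   rewrite /pres_class reprK.
Qed.

Lemma pres_mulA : associative pres_mul.
Proof.
move=> a b c; have [u ->] := pres_class_surj a.
have [v ->] := pres_class_surj b; have [w ->] := pres_class_surj c.
by rewrite !pres_mulE mulgA.
Qed.

Lemma pres_mul1 : left_id (pres_class 1) pres_mul.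
Proof. by move=> a; have [u ->] := pres_class_surj a; rewrite pres_mulE mul1g. Qed.

Lemma pres_mulr1 : right_id (pres_class 1) pres_mul.
Proof. by move=> a; have [u ->] := pres_class_surj a; rewrite pres_mulE mulg1. Qed.

HB.instance Definition _ :=
  isMonoid.Build presMonoid pres_mulA pres_mul1 pres_mulr1.

Lemma pres_class_monoid_morphism : monoid_morphism pres_class.
Proof. by split=> // u v; rewrite -pres_mulE. Qed.

End Presentation.

Notation alpha1 := (gen (@Ordinal 4 0 isT)).
Notation alpha2 := (gen (@Ordinal 4 1 isT)).
Notation alpha3 := (gen (@Ordinal 4 2 isT)).
Notation alpha4 := (gen (@Ordinal 4 3 isT)).

Inductive P4_rel : freeMonoid 'I_4 -> freeMonoid 'I_4 -> Prop :=
| P4_rel12 : P4_rel (alpha1 * alpha2) (alpha2 * alpha1)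
| P4_rel23 : P4_rel (alpha2 * alpha3) (alpha3 * alpha2)
| P4_rel34 : P4_rel (alpha3 * alpha4) (alpha4 * alpha3).

Notation T_P4 := (presMonoid P4_rel).

(* The letters x and y are encoded as [true] and [false]. *)
Notation M2 := (freeMonoid bool).

(* Main.v *)
Require Import Defs.
From mathcomp Require Import all_boot.

(** Project a trace onto each pair of non-commuting generators, here [{1, 3}],
    [{1, 4}] and [{2, 4}].  These projections determine the trace: if [a u] and
    [v] have the same projections, then [a] occurs in [v] and every letter before
    its first occurrence commutes with [a], so [v] is congruent to [a v'], and the
    projections of [u] and [v'] again agree. *)

Set Implicit Arguments.
Unset Strict Implicit.
Unset Printing Implicit Defensive.

Local Open Scope group_scope.

Lemma filter_rem (T : eqType) (P : pred T) (a : T) (s : seq T) :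
  filter P (rem a s) = rem a (filter P s).
Proof.
elim: s => //= c s IHs; have [->|ca] := eqVneq c a; last first.
  by rewrite /= IHs; case: ifP => //= _; rewrite (negPf ca).
case: ifP => [_|/negbT Pa] /=; first by rewrite eqxx.
by rewrite rem_id // mem_filter (negPf Pa).
Qed.

Section PresentationMorphism.
Variables (A : choiceType) (R : freeMonoid A -> freeMonoid A -> Prop).
Variables (M : monoidType) (h : freeMonoid A -> M).
Hypothesis h_morph : monoid_morphism h.
Hypothesis h_rel : forall u v, R u v -> h u = h v.

Lemma pres_cong_morph u v : pres_cong R u v -> h u = h v.
Proof.
elim=> {u v} [u v /h_rel //|//|//|u v w _ -> _ -> //|u u' v v' _ Eu _ Ev].
by rewrite !h_morph.2 Eu Ev.
Qed.

Definition pres_lift (t : presMonoid R) : M := h (repr t).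

Lemma pres_liftE u : pres_lift (pres_class R u) = h u.
Proof.
by apply: pres_cong_morph; apply/pres_classP; rewrite /pres_class reprK.
Qed.

Lemma pres_lift_morph : monoid_morphism pres_lift.
Proof.
split=> [|s t]; first by rewrite [LHS]pres_liftE h_morph.1.
have [u ->] := pres_class_surj s; have [v ->] := pres_class_surj t.
by rewrite -(pres_class_monoid_morphism R).2 !pres_liftE h_morph.2.
Qed.

End PresentationMorphism.

Section Projections.
Variables (A : choiceType) (R : freeMonoid A -> freeMonoid A -> Prop).
Variable I : rel A.
Hypothesis I_irr : irreflexive I.
Hypothesis I_comm :
  forall a b, I a b -> pres_cong R (gen a * gen b) (gen b * gen a).

Lemma pres_cong_cons a (u v : freeMonoid A) :
  pres_cong R u v -> pres_cong R (a :: u) (a :: v).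
Proof. exact: (pres_cong_mul (pres_cong_refl R (gen a))). Qed.

(** The second hypothesis says that no letter failing to commute with [a] precedes the first [a]; it
    passes to tails, so [a] moves left past one letter at a time. *)
Lemma pres_cong_to_front a (v : freeMonoid A) : a \in (v : seq A) ->
    (forall b, ~~ I a b -> exists s, filter (pred2 a b) v = a :: s) ->
  pres_cong R (a :: rem a v) v.
Proof.
elim: v => //= c v IHv; rewrite inE eq_sym.
have [-> _ _|ca /= av hd] := eqVneq c a; first exact: pres_cong_refl.
(* Otherwise the projection onto [a] and [c] would start with [c], forcing [c = a]. *)
have Iac : I a c.
  apply: contraNT ca => /hd[s]; rewrite /= eqxx => -[ca _].
  exact/eqP.
apply: pres_cong_trans _ (pres_cong_cons c (IHv av _)) => [|b nIab].
  exact: (pres_cong_mul (I_comm Iac) (pres_cong_refl R (rem a v))).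
have [s] := hd b nIab.
by case: eqP => [cb|_ ->]; [rewrite -cb Iac in nIab | exists s].
Qed.

Lemma pres_cong_projections (u v : freeMonoid A) :
    (forall a b, ~~ I a b -> filter (pred2 a b) u = filter (pred2 a b) v) ->
  pres_cong R u v.
Proof.
elim: u v => [|a u IHu] v uv.
  case: v uv => [|b v] uv; first exact: pres_cong_refl.
  (* The diagonal projection onto [b] alone, available by irreflexivity, is empty on one side
     only. *)
  by have := uv b b; rewrite I_irr /= eqxx => /(_ isT).
have av : a \in (v : seq A).
  have: a \in filter (pred2 a a) v by rewrite -uv ?I_irr //= eqxx mem_head.
  by rewrite mem_filter => /andP[].
apply: pres_cong_trans _ (pres_cong_to_front av _) => [|b nIab]; last first.
  by rewrite -uv //= eqxx; eexists.
apply: pres_cong_cons; apply: IHu => b c nIbc.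
(* Deleting the first [a] commutes with projecting, so it can be carried over to [a :: u], where it
   leaves [u]. *)
by rewrite filter_rem -uv // -filter_rem /= eqxx.
Qed.

End Projections.

Section PairProjection.
Variables (A : choiceType) (a b : A).

Definition pair_proj (w : freeMonoid A) : M2 :=
  [seq c == a | c <- w & pred2 a b c].

Lemma pair_proj_morph : monoid_morphism pair_proj.
Proof. by split=> // u v; rewrite /pair_proj filter_cat map_cat. Qed.

Lemma pair_proj_inj u v : pair_proj u = pair_proj v ->
  filter (pred2 a b) u = filter (pred2 a b) v.
Proof.
have code w : filter (pred2 a b) w =
    [seq (if e then a else b) | e : bool <- pair_proj w].
  rewrite -map_comp -[LHS]map_id; apply/eq_in_map => c.
  by rewrite mem_filter /= => /andP[/pred2P[]-> _]; case: eqP.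
by rewrite !code => ->.
Qed.

(** Projecting onto one letter factors through any pair containing it; this supplies the diagonal
    cases of [pres_cong_projections]. *)
Lemma pair_proj_inj1 u v c : c \in pred2 a b -> pair_proj u = pair_proj v ->
  filter (pred2 c c) u = filter (pred2 c c) v.
Proof.
move=> cab /pair_proj_inj uv.
have sub w : filter (pred2 c c) w = filter (pred2 c c) (filter (pred2 a b) w).
  rewrite -filter_predI; apply: eq_filter => d /=.
  by rewrite orbb; case: eqP => // ->; rewrite [RHS]cab.
by rewrite (sub u) uv -sub.
Qed.

End PairProjection.

Local Notation i1 := (@Ordinal 4 0 isT).
Local Notation i2 := (@Ordinal 4 1 isT).
Local Notation i3 := (@Ordinal 4 2 isT).
Local Notation i4 := (@Ordinal 4 3 isT).

Definition P4_edge : rel 'I_4 := fun i j => (i.+1 == j) || (j.+1 == i).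

Lemma P4_edge_irr : irreflexive P4_edge.
Proof.
by move=> i; rewrite /P4_edge orbb; apply/negbTE; rewrite neq_ltn ltnSn orbT.
Qed.

Lemma P4_edge_comm i j : P4_edge i j ->
  pres_cong P4_rel (gen i * gen j) (gen j * gen i).
Proof.
wlog ij : i j / i.+1 == j.
  by move=> W /orP[] h; [|apply: pres_cong_sym]; apply: W; rewrite /P4_edge ?h.
move=> _; apply: pres_cong_rel; case: i ij => i lti; case: j => j ltj /= /eqP ij.
(* The bound proofs are turned into [isT] so that the letters are literally those of [P4_rel]. *)
move: lti ltj; rewrite -{}ij; case: i => [|[|[|i]]] // lti ltj;
  rewrite (bool_irrelevance lti isT) (bool_irrelevance ltj isT).
- exact: P4_rel12.
- exact: P4_rel23.
- exact: P4_rel34.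
Qed.

Definition P4_proj (w : freeMonoid 'I_4) : (M2 * M2 * M2)%type :=
  (pair_proj i1 i3 w, pair_proj i1 i4 w, pair_proj i2 i4 w).

Lemma P4_proj_morph : monoid_morphism P4_proj.
Proof. by split=> // u v; rewrite /P4_proj !(pair_proj_morph _ _).2. Qed.

(** Each of the three pairs contains at most one of two commuting generators, so both sides of a
    relation project to the same word by computation. *)
Lemma P4_proj_rel u v : P4_rel u v -> P4_proj u = P4_proj v.
Proof. by case. Qed.

Lemma P4_proj_cong u v : P4_proj u = P4_proj v -> pres_cong P4_rel u v.
Proof.
case=> e13 e14 e24; apply: (pres_cong_projections P4_edge_irr P4_edge_comm).
have swap i j : filter (pred2 i j) u = filter (pred2 i j) v ->
    filter (pred2 j i) u = filter (pred2 j i) v.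
  by rewrite !(@eq_filter _ (pred2 j i) (pred2 i j)) // => k /=; rewrite orbC.
suff W (i j : 'I_4) : i <= j -> ~~ P4_edge i j ->
    filter (pred2 i j) u = filter (pred2 i j) v.
  move=> i j; case/orP: (leq_total i j) => ij nE; first exact: W.
  by apply/swap/W => //; rewrite /P4_edge orbC.
have [{j}<- _ _|ne] := eqVneq i j.
  (* The pairs [{1, 3}] and [{2, 4}] together cover all four letters, which settles the diagonal. *)
  have [i13|] := boolP (i \in pred2 i1 i3); first exact: pair_proj_inj1 e13.
  move=> n13; apply: pair_proj_inj1 e24.
  by case: i n13 => -[|[|[|[|]]]].
move=> ij nE.
(* These are the non-edges of the path with [i < j], exactly the pairs used in [P4_proj]. *)
have [[-> ->]|[-> ->]|[-> ->]] :
    [\/ i = i1 /\ j = i3, i = i1 /\ j = i4 | i = i2 /\ j = i4].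
  case: i ne ij nE => -[|[|[|[|//]]]] pi; case: j => -[|[|[|[|//]]]] pj // _ _ _.
  - by constructor 1; split; apply: val_inj.
  - by constructor 2; split; apply: val_inj.
  - by constructor 3; split; apply: val_inj.
- exact: pair_proj_inj.
- exact: pair_proj_inj.
- exact: pair_proj_inj.
Qed.

Theorem lemma8p6 :
  exists f : T_P4 -> (M2 * M2 * M2)%type, monoid_morphism f /\ injective f.
Proof.
exists (pres_lift P4_proj); split.
  exact: pres_lift_morph P4_proj_morph P4_proj_rel.
move=> s t; have [u ->] := pres_class_surj s; have [v ->] := pres_class_surj t.
rewrite !(pres_liftE P4_proj_morph P4_proj_rel) => /P4_proj_cong uv.
exact/pres_classP.
Qed.
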